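(* Let $f,g:(0,\infty)\to(0,\infty)$ be strictly increasing functions with $$\lim_{n\to\infty}f(n)=\infty\quad\text{and}\quad\lim_{n\to\infty}\frac{g(n)\ln n}{n}=0,$$ and let $C,B,R\ge1$ and $0<\delta,\varepsilon<1$. Assume that $(x_i,f_i)_{i=1}^N$ is a frame of a Banach space $X$ with $\dim(X)=n<\infty$, and that $Z$ is an $N$-dimensional space, $N\in\mathbb{N}$, with basis $(z_i)_{i=1}^N$, which is associated to $(x_i,f_i)_{i=1}^N$. Let $T:X\to Z$ and $S:Z\to X$ be the associated decomposition and reconstruction operators and let $K_Z$ be the projection constant of $(z_i)$. Put $$\mathcal{F}_{(\delta,C)}(x_i)=\Big\{\sum_{j=1}^N n_j\delta x_j:\ (n_j)_{j=1}^N\subset\mathbb{Z},\ \Big\|\sum_{j=1}^N n_j\delta z_j\Big\|\le C\Big\}.$$ Assume that (i) $\mathcal{F}_{(\delta,C)}(x_i)$ is $\varepsilon$-dense in $B_X$, and (ii) $f(\#A)\le\big\|\sum_{j\in A}n_jz_j\big\|$ whenever $\emptyset\ne A\subset\{1,2,\ldots,N\}$ and $(n_j)_{j\in A}\subset\mathbb{Z}\setminus\{0\}$. Then $$\ln N\ge\frac{n\ln(1/\varepsilon)}{f^{-1}(C/\delta)}-\ln\Big(\frac{4K_ZC}{\delta}+1\Big).$$ In addition, there is an $n_0\in\mathbb{N}$ (depending on $C,B,R,\varepsilon,\delta,f$ and $g$) such that if, moreover, $K_Z\le B$, $\|S\|\le R$ and (iii) $g(\#A)\ge\sup\big\|\sum_{j\in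 A}\pm z_j\big\|$ (supremum over all choices of signs) whenever $\emptyset\neq A\subset\{1,2,\ldots,N\}$, then $n\le n_0$.
   Context: All Banach spaces are real; $B_X$ is the closed unit ball; $\#A$ is the cardinality of $A$; $f^{-1}$ is the inverse function of $f$. A set $D$ is $\varepsilon$-dense in $B_X$ if for every $x\in B_X$ there is $d\in D$ with $\|x-d\|\le\varepsilon$. A finite sequence $(x_i,f_i)_{i=1}^N$ with $x_i\in X$, $f_i\in X^*$ is a frame of $X$ if $x=\sum_{i=1}^Nf_i(x)x_i$ for all $x\in X$. A space $Z$ with basis $(z_i)_{i=1}^N$ is associated to this frame via the maps $S:Z\to X$, $\sum a_iz_i\mapsto\sum a_ix_i$ (associated reconstruction operator), and $T:X\to Z$, $x\mapsto\sum_{x_i\ne0}f_i(x)z_i$ (associated decomposition operator), which are required to be bounded. The projection constant of the basis $(z_i)$ is $K_Z=\sup_{0\le m\le n\le N}\|P_n-P_m\|$, where $P_0=0$ and $P_n(\sum a_iz_i)=\sum_{i\le n}a_iz_i$.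
   Formalization: The lower bound for ln N is proved under the added assumption ‖z_j‖ ≥ 1/2 for all j (it fails for bases with very small vectors); f^{-1}(y) is read as sup{t>0 : f(t) ≤ y}. The statement n ≤ n_0 is proved without the added assumption. *)

(* Defs.v *)
From mathcomp Require Import all_boot all_order all_algebra.
From mathcomp Require Import all_classical all_reals all_analysis.

Set Implicit Arguments.
Unset Strict Implicit.
Unset Printing Implicit Defensive.

Import Order.TTheory GRing.Theory Num.Theory numFieldNormedType.Exports.

Local Open Scope classical_set_scope.
Local Open Scope ring_scope.

Section FiniteBases.
Context {R : realType}.

Definition is_basis (V : lmodType R) (k : nat) (e : 'I_k -> V) : Prop :=
  forall v, exists! a : {ffun 'I_k -> R}, v = \sum_i a i *: e i.

Definition has_dim (V : lmodType R) (k : nat) : Prop :=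
  exists e : 'I_k -> V, is_basis e.

(* Meaningful only when e is a basis. *)
Definition coef (V : lmodType R) (k : nat) (e : 'I_k -> V) (v : V) :
    {ffun 'I_k -> R} :=
  xget [ffun => 0] [set a : {ffun 'I_k -> R} | v = \sum_i a i *: e i].

End FiniteBases.

Section Operators.
Context {R : realType}.

Definition bounded_op (V W : normedModType R) (L : V -> W) : Prop :=
  exists M : R, forall v, `|L v| <= M * `|v|.

(* A real supremum: meaningful only for bounded linear L, which includes every
   linear map with finite-dimensional domain. *)
Definition op_norm (V W : normedModType R) (L : V -> W) : R :=
  sup [set `|L v| | v in [set v | `|v| <= 1]].

(* P_m, with the basis vectors numbered from 0. *)
Definition basis_proj (Z : normedModType R) (N : nat) (z : 'I_N -> Z)
    (m : nat) (v : Z) : Z :=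
  \sum_(i < N | (i < m)%N) coef z v i *: z i.

Definition proj_const (Z : normedModType R) (N : nat) (z : 'I_N -> Z) : R :=
  sup [set op_norm (fun v => basis_proj z p.2 v - basis_proj z p.1 v)
      | p in [set p : nat * nat | (p.1 <= p.2 <= N)%N]].

End Operators.

Section Frames.
Context {R : realType}.

Definition is_frame (X : normedModType R) (N : nat) (x : 'I_N -> X)
    (phi : 'I_N -> {linear X -> R^o}) : Prop :=
  (forall i, continuous (phi i : X -> R^o)) /\
  (forall v, v = \sum_i phi i v *: x i).

Definition reconstruction (X Z : normedModType R) (N : nat) (x : 'I_N -> X)
    (z : 'I_N -> Z) (v : Z) : X :=
  \sum_i coef z v i *: x i.

Definition decomposition (X Z : normedModType R) (N : nat) (x : 'I_N -> X)
    (phi : 'I_N -> {linear X -> R^o}) (z : 'I_N -> Z) (v : X) : Z :=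
  \sum_(i < N | x i != 0) phi i v *: z i.

Definition is_associated (X Z : normedModType R) (N : nat) (x : 'I_N -> X)
    (phi : 'I_N -> {linear X -> R^o}) (z : 'I_N -> Z) : Prop :=
  [/\ is_basis z, bounded_op (reconstruction x z)
    & bounded_op (decomposition x phi z)].

Definition quantized (X Z : normedModType R) (N : nat) (delta C : R)
    (x : 'I_N -> X) (z : 'I_N -> Z) : set X :=
  [set \sum_j ((m j)%:~R * delta) *: x j
  | m in [set m : 'I_N -> int | `|\sum_j ((m j)%:~R * delta) *: z j| <= C]].

Definition eps_dense (X : normedModType R) (eps : R) (D : set X) : Prop :=
  forall v : X, `|v| <= 1 -> exists2 d, D d & `|v - d| <= eps.

(* The sup of |sum_(j in A) +/- z_j| over the finitely many sign choices. *)
Definition max_signs (Z : normedModType R) (N : nat) (z : 'I_N -> Z)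
    (A : {set 'I_N}) : R :=
  \big[Num.max/0]_(s : {ffun 'I_N -> bool}) `|\sum_(j in A) (-1) ^+ s j *: z j|.

End Frames.

Section Inverse.
Context {R : realType}.

Definition pos_increasing (f : R -> R) : Prop :=
  (forall t, 0 < t -> 0 < f t) /\ (forall s t, 0 < s -> s < t -> f s < f t).

(* Inverse of a strictly increasing f on (0, oo). Such an f need not be onto;
   the supremum extends the inverse to values y that f jumps over, and agrees
   with it on the range of f (inv_incK). *)
Definition inv_inc (f : R -> R) (y : R) : R := sup [set t | 0 < t /\ f t <= y].

Lemma inv_incK (f : R -> R) (t : R) :
  pos_increasing f -> 0 < t -> inv_inc f (f t) = t.
Proof.
move=> [_ finc] t0; have ub : ubound [set s | 0 < s /\ f s <= f t] t.
  move=> s /= [s0 fst]; rewrite leNgt; apply/negP => ts.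
  by have := finc _ _ t0 ts; rewrite ltNge fst.
apply/eqP; rewrite eq_le; apply/andP; split.
  by apply: ge_sup => //; exists t.
by apply: ub_le_sup; [exists t | split].
Qed.

End Inverse.

(* Main.v *)
(* A quantized point of the unit ball uses at most k = f^-1(C/delta) vectors
   x_j, by (ii), with coefficients of modulus at most K = P C / (delta L),
   where P bounds K_Z and L bounds the norms of the z_j from below; so the set
   of quantized points has at most (N (2K+1))^k elements. An eps-net of the
   unit ball of an n-dimensional space has at least eps^-n elements, which
   gives the lower bound for ln N.
   For the second part, discarding the vectors x_j of norm less than a small
   constant r costs little density, so the number a of remaining vectors also
   satisfies ln a >= c n - c'. As the 1-summing norm of the identity of X is at
   most n, a r <= sum |x_j| <= n M g(a), whence ln a = o(n) by the assumption
   on g, and n is bounded. *)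
Require Import Defs.
From mathcomp Require Import all_boot all_order all_algebra.
From mathcomp Require Import all_classical all_reals all_analysis.
From mathcomp Require Import ring lra zify.
Import Order.TTheory GRing.Theory Num.Theory numFieldNormedType.Exports.
Set Implicit Arguments.
Unset Strict Implicit.
Unset Printing Implicit Defensive.
Local Open Scope classical_set_scope.
Local Open Scope ring_scope.

(** * Coordinates with respect to an algebraic basis *)

Section Coordinates.
Context {R : realType} {V : lmodType R} {k : nat} {e : 'I_k -> V}.
Hypothesis he : is_basis e.

Lemma coef_sum (v : V) : v = \sum_i coef e v i *: e i.
Proof.
have [a [av _]] := he v.
by have := @xgetPex _ [ffun=> 0] [set a : {ffun 'I_k -> R} | v = \sum_i a i *: e i]
  (ex_intro _ a av).
Qed.

Lemma coef_unique (v : V) (a : {ffun 'I_k -> R}) :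
  v = \sum_i a i *: e i -> coef e v = a.
Proof.
move=> va; have [b [_ bu]] := he v.
by rewrite -(bu _ va); apply/esym/bu/coef_sum.
Qed.

Lemma coefZ (t : R) (v : V) (i : 'I_k) : coef e (t *: v) i = t * coef e v i.
Proof.
rewrite (@coef_unique _ [ffun i => t * coef e v i]) ?ffunE//.
by rewrite {1}(coef_sum v) scaler_sumr; apply: eq_bigr => j _; rewrite ffunE scalerA.
Qed.

Lemma coefD (u v : V) (i : 'I_k) : coef e (u + v) i = coef e u i + coef e v i.
Proof.
rewrite (@coef_unique _ [ffun i => coef e u i + coef e v i]) ?ffunE//.
rewrite {1}(coef_sum u) {1}(coef_sum v) -big_split/=.
by apply: eq_bigr => j _; rewrite ffunE scalerDl.
Qed.

Lemma coefB (u v : V) (i : 'I_k) : coef e (u - v) i = coef e u i - coef e v i.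
Proof. by rewrite coefD -scaleN1r coefZ mulN1r. Qed.

Lemma coef0 (i : 'I_k) : coef e 0 i = 0.
Proof. by rewrite -(scale0r (0 : V)) coefZ mul0r. Qed.

Lemma coef_lincomb (I : finType) (a : I -> R) (y : I -> V) (i : 'I_k) :
  coef e (\sum_j a j *: y j) i = \sum_j a j * coef e (y j) i.
Proof.
rewrite (big_morph (fun v => coef e v i) (fun u v => coefD u v i) (coef0 i)).
by apply: eq_bigr => j _; rewrite coefZ.
Qed.

End Coordinates.

(** * Continuity of the coordinate functionals *)

Section BoundedCoordinates.
Context {R : realType} {Z : normedModType R} {k : nat} {z : 'I_k -> Z}.
Hypothesis hz : is_basis z.

(* The norm attains a positive minimum over the compact sphere of coordinate
   vectors of sup-norm 1. *)
Lemma coef_bounded : exists2 c : R, 0 < c & forall v i, `|coef z v i| <= c * `|v|.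
Proof.
case: k z hz => [|n] e he; first by exists 1 => // v [].
pose f (a : 'rV[R]_n.+1) : R := `|\sum_i a 0 i *: e i|.
have cf : continuous f.
  have cs : continuous (fun a : 'rV[R]_n.+1 => \sum_i a 0 i *: e i).
    apply: continuous_big => [|i _ b]; first exact: add_continuous.
    by apply: (@cvgZr_tmp _ _ _ (nbhs b)); exact: (@coord_continuous R 1 n.+1 0 i b).
  by move=> a; apply: (@cvg_norm _ _ _ (nbhs a)); exact: cs.
pose S := [set a : 'rV[R]_n.+1 | `|a| = 1].
have cS : compact S.
  apply: bounded_closed_compact.
    by exists 1; split => // x x1 a /= ->; exact: ltW.
  rewrite (_ : S = (fun a => `|a|) @^-1` [set x | x = 1]) //.
  have nc : continuous (fun a : 'rV[R]_n.+1 => `|a| : R) by exact: norm_continuous.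
  by have /continuous_closedP := nc; apply; exact: closed_eq.
have nS (a : 'rV[R]_n.+1) : a != 0 -> S (`|a|^-1 *: a).
  move=> an0; suff : `| `|a|^-1 *: a | = 1 by [].
  by rewrite normrZ normfV normr_id mulVf ?normr_eq0.
have S0 : S !=set0.
  exists (`|const_mx 1 : 'rV[R]_n.+1|^-1 *: const_mx 1); apply: nS.
  by apply/eqP => /rowP /(_ 0); rewrite !mxE; apply/eqP; rewrite oner_eq0.
have [a0 + amin] := EVT_min_rV S0 cS (continuous_subspaceT cf).
rewrite inE /= => a0S.
(* If [f a0] were 0, uniqueness of the coordinates of 0 would give [a0 = 0], which is not on the
   sphere. *)
have mu0 : 0 < f a0.
  rewrite normr_gt0; apply: contra_eq_neq a0S => /eqP; rewrite eq_sym => /eqP fa0.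
  suff -> : a0 = 0 by rewrite normr0 eq_sym oner_eq0.
  apply/rowP => i; rewrite mxE; have := @coef0 _ _ _ _ he i.
  rewrite (@coef_unique _ _ _ _ he 0 [ffun i => a0 0 i]) ?ffunE//.
  by apply: etrans fa0 _; apply: eq_bigr => j _; rewrite ffunE.
exists (f a0)^-1 => [|v i]; first by rewrite invr_gt0.
pose a : 'rV[R]_n.+1 := \row_i coef e v i.
have av : `|coef e v i| <= `|a|.
  rewrite [leRHS]/Num.Def.normr/= mx_normrE; apply/bigmax_geP; right.
  by exists (0, i) => //=; rewrite mxE.
apply: le_trans av _; have [->|an0] := eqVneq a 0.
  by rewrite normr0 mulr_ge0// invr_ge0 ltW.
rewrite ler_pdivlMl// mulrC.
have : f a0 <= f (`|a|^-1 *: a).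
  by apply: amin; rewrite inE; exact: nS.
have -> : f (`|a|^-1 *: a) = `|a|^-1 * `|v|.
  rewrite {1}(coef_sum he v) /f -[in RHS](normr_id a) -normfV -normrZ scaler_sumr.
  by congr (`| _ |); apply: eq_bigr => j _; rewrite !mxE scalerA.
by rewrite ler_pdivlMl ?normr_gt0.
Qed.

End BoundedCoordinates.

(** * Cardinality of nets of the unit ball *)

Section Covering.
Context {R : realType} {X : normedModType R}.

Definition is_net (I : finType) (u : I -> X) (r : R) : Prop :=
  forall v : X, `|v| <= 1 -> exists i, `|v - u i| <= r.

(** The error left by a point of the [k]-th net, divided by [eps ^+ k], lies in the unit ball again,
    so [u] approximates it and the radius shrinks by another factor [eps]. *)
Lemma is_net_iter (I : finType) (u : I -> X) (eps : R) (k : nat) :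
  0 < eps -> is_net u eps ->
  exists (J : finType) (w : J -> X), #|J| = (#|I| ^ k)%N /\ is_net w (eps ^+ k).
Proof.
move=> eps0 unet; elim: k => [|k [J [w [cJ wnet]]]].
  exists unit, (fun=> 0); split; first by rewrite card_unit.
  by move=> v v1; exists tt; rewrite subr0.
exists (J * I)%type, (fun p => w p.1 + eps ^+ k *: u p.2); split.
  by rewrite card_prod cJ expnSr.
move=> v /wnet[j vj]; have ek0 : 0 < eps ^+ k by rewrite exprn_gt0.
have [|i vi] := unet ((eps ^+ k)^-1 *: (v - w j)).
  by rewrite normrZ gtr0_norm ?invr_gt0// ler_pdivrMl// mulr1.
exists (j, i) => /=; rewrite opprD addrA.
have -> : v - w j - eps ^+ k *: u i = eps ^+ k *: ((eps ^+ k)^-1 *: (v - w j) - u i).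
  by rewrite scalerBr scalerA divff ?scale1r// gt_eqF.
by rewrite normrZ gtr0_norm// exprSr ler_wpM2l// ltW.
Qed.

(* The lattice points of mesh [3 c r] in the unit ball are more than [2 r]
   apart, [c] bounding the coordinate functionals. *)
Lemma net_card_ge_crude (n : nat) (e : 'I_n -> X) : is_basis e ->
  exists2 kap : R, 0 < kap & forall (J : finType) (w : J -> X) (r : R),
    0 < r -> is_net w r -> 1 <= #|J|%:R * (kap * r) ^+ n.
Proof.
move=> he; have [c c0 ec] := coef_bounded he.
pose b := 1 + \sum_i `|e i|; have b0 : 0 < b by rewrite ltr_pwDl// sumr_ge0.
exists (3 * c * b) => [|J w r r0 wnet]; first by rewrite !mulr_gt0.
pose h := 3 * c * r; have h0 : 0 < h by rewrite !mulr_gt0.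
(* Largest [K] with [h * K * b <= 1]: this keeps the lattice points with coordinates
   [0, h, ..., K h] in the unit ball. *)
pose K := Num.truncn (h * b)^-1.
have /andP[Kle Klt] : K%:R <= (h * b)^-1 < K.+1%:R.
  by apply: truncn_itv; rewrite invr_ge0 mulr_ge0// ltW.
pose p (g : {ffun 'I_n -> 'I_K.+1}) : X := \sum_i (h * (g i)%:R) *: e i.
have coefp g i : coef e (p g) i = h * (g i)%:R.
  rewrite (coef_unique he (a := [ffun i => h * (g i)%:R])) ?ffunE//.
  by apply: eq_bigr => j _; rewrite ffunE.
have p1 g : `|p g| <= 1.
  have hK0 m : 0 <= h * m%:R by rewrite pmulr_rge0.
  apply: (@le_trans _ _ (h * K%:R * b)).
    rewrite mulrDr mulr1 mulr_sumr ler_wpDl// /p (le_trans (ler_norm_sum _ _ _))//.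
    apply: ler_sum => i _; rewrite normrZ ler_wpM2r// ger0_norm//.
    by rewrite ler_pM2l// ler_nat -ltnS.
  by rewrite mulrAC -ler_pdivlMl ?mulr1// pmulr_rgt0.
have /choice[phi phiP] : forall g, exists j, `|p g - w j| <= r.
  by move=> g; exact: wnet.
(* Lattice points assigned to the same [w j] are at most [2 r] apart, so their coordinates differ by
   at most [2 c r < h], hence not at all. *)
have phi_inj : injective phi.
  move=> g g' gg'; apply/ffunP => i; apply/val_inj/eqP => /=.
  have d2 : `|p g - p g'| <= r + r.
    rewrite -(subrKA (w (phi g))) (le_trans (ler_normD _ _))// lerD//.
    by rewrite distrC gg'.
  have := ec (p g - p g') i; rewrite (coefB he) !coefp -mulrBr normrM gtr0_norm//.
  move=> /le_trans /(_ (ler_wpM2l (ltW c0) d2)) hle.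
  have /= : `|(g i)%:R - (g' i)%:R : R| < 1.
    rewrite -(ltr_pM2l h0) mulr1 (le_lt_trans hle)// /h.
    by have := mulr_gt0 c0 r0; nra.
  rewrite !pmulrn -intrB -intr_norm.
  by rewrite (ltr_int R _ 1); lia.
have := leq_card phi phi_inj; rewrite card_ffun !card_ord => cJ.
have kr0 : 0 < 3 * c * b * r by rewrite !mulr_gt0.
(* [3 c b r] is [h * b], and [K.+1 * (h * b) > 1] by the choice of [K]. *)
apply: (@le_trans _ _ (K.+1%:R ^+ n * (3 * c * b * r) ^+ n)).
  rewrite -exprMn exprn_ege1//.
  move: Klt; rewrite -[_^-1]mul1r ltr_pdivrMr ?mulr_gt0// => /ltW /le_trans; apply.
  by rewrite le_eqVlt /h; apply/orP; left; apply/eqP; ring.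
by rewrite ler_pM2r ?exprn_gt0// -natrX ler_nat.
Qed.

(* Iterating the net [k] times removes the constant of the crude bound as
   [k] tends to infinity. *)
Lemma net_card_ge (n : nat) (I : finType) (u : I -> X) (eps : R) :
  has_dim X n -> 0 < eps -> is_net u eps -> 1 <= #|I|%:R * eps ^+ n.
Proof.
move=> [e he] eps0 unet; have [kap kap0 crude] := net_card_ge_crude he.
set q := _ * _; have q0 : 0 <= q by rewrite mulr_ge0// exprn_ge0// ltW.
have kq k : 1 <= kap ^+ n * q ^+ k.
  have [J [w [cJ wnet]]] := is_net_iter k eps0 unet.
  have := crude J w _ (exprn_gt0 k eps0) wnet.
  by rewrite cJ natrX !exprMn mulrCA (exprAC eps).
rewrite leNgt; apply/negP => q1.
have /cvgr_lt/(_ (kap ^+ n)^-1) : q ^+ k @[k --> \oo] --> 0.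
  by apply: cvg_expr; rewrite ger0_norm.
rewrite invr_gt0 exprn_gt0// => /(_ isT)/filter_ex[k].
by rewrite ltNge /= -[leLHS]mulr1 ler_pdivrMl ?exprn_gt0// kq.
Qed.

End Covering.

(** * Nets made of sparse integer combinations *)

Section SparseNets.
Context {R : realType} {X : normedModType R}.

(** A combination with at most [k] terms is a word of [k] pairs (index, coefficient), the
    coefficient in [[-K, K]] being stored shifted by [K]; the words index a net, to which
    [net_card_ge] applies. *)
Lemma sparse_net_card (n : nat) (J : finType) (y : J -> X) (k K : nat)
    (delta eps : R) (j0 : J) :
  has_dim X n -> 0 < eps ->
  (forall v : X, `|v| <= 1 -> exists m : J -> int,
    [/\ (#|[pred j | m j != 0]| <= k)%N, forall j, (`|m j| <= K)%N
      & `|v - \sum_j ((m j)%:~R * delta) *: y j| <= eps]) ->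
  1 <= ((#|J| * K.*2.+1) ^ k)%:R * eps ^+ n.
Proof.
move=> dX eps0 dense.
pose val (a : 'I_K.*2.+1) : int := a%:Z - K%:Z.
pose u (t : {ffun 'I_k -> J * 'I_K.*2.+1}) : X :=
  \sum_i ((val (t i).2)%:~R * delta) *: y (t i).1.
have := @net_card_ge _ _ n _ u eps dX eps0.
rewrite card_ffun card_prod !card_ord; apply => v /dense[m [mk mK vm]].
pose s := enum [pred j | m j != 0].
have ss : (size s <= k)%N by rewrite -cardE.
(* The support of [m] is listed and padded to length [k] with the index [j0] and the coefficient 0,
   stored as [K]. *)
pose t : {ffun 'I_k -> J * 'I_K.*2.+1} := [ffun i : 'I_k =>
  let j := nth j0 s i in (j, inord `|(if (i < size s)%N then m j else 0) + K%:Z|)].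
exists t; suff -> : u t = \sum_j ((m j)%:~R * delta) *: y j by [].
pose H j : X := ((m j)%:~R * delta) *: y j.
have -> : u t = \sum_(i < k) if (i < size s)%N then H (nth j0 s i) else 0.
  apply: eq_bigr => i _; rewrite ffunE /= /val inordK; last first.
    by case: ifP => _; have := mK (nth j0 s i); lia.
  case: ifP => _; last by rewrite add0r subrr mul0r scale0r.
  rewrite /H; congr ((_%:~R * _) *: _).
  by have := mK (nth j0 s i); lia.
rewrite -big_mkcond -(big_ord_widen _ (fun i => H (nth j0 s i)) ss).
rewrite -(big_mkord xpredT (fun i => H (nth j0 s i))) -(big_nth j0 xpredT H) big_enum /=.
rewrite big_mkcond; apply: eq_bigr => j _; rewrite inE.
by case: eqP => //= mj; rewrite mj mul0r scale0r.
Qed.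

(** The one-point net at 0 forces [1 <= eps ^+ n]. This settles the degenerate cases below, where
    only the zero combination is available. *)
Lemma zero_net_dim (n : nat) (eps : R) : has_dim X n -> 0 < eps < 1 ->
  (forall v : X, `|v| <= 1 -> `|v| <= eps) -> n = 0%N.
Proof.
move=> dX /andP[eps0 eps1] net0.
have := @net_card_ge _ _ n unit (fun=> 0) eps dX eps0.
rewrite card_unit mul1r => /(_ _)/wrap[v v1|].
  by exists tt; rewrite subr0 net0.
case: n dX => // n _; rewrite leNgt => /negP[].
by rewrite exprn_ilt1 // ltW.
Qed.

End SparseNets.

(** * Operator norms and the projection constant *)

Section Projections.
Context {R : realType}.

(** Boundedness makes the supremum in [op_norm] a genuine upper bound, and homogeneity reduces to
    the vector [v] divided by its norm. *)
Lemma op_norm_bound (V W : normedModType R) (L : V -> W) (v : V) :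
  (forall (t : R) u, L (t *: u) = t *: L u) -> bounded_op L ->
  `|L v| <= op_norm L * `|v|.
Proof.
move=> LZ [M LM].
have ubL : has_ubound [set `|L v| | v in [set v | `|v| <= 1]].
  exists `|M| => _ [u /= u1 <-]; apply: le_trans (LM u) _.
  by rewrite (le_trans (ler_wpM2r _ (ler_norm M)))// ler_piMr.
have [->|v0] := eqVneq v 0.
  by rewrite -(scale0r (0 : V)) LZ !scale0r !normr0 mulr0.
rewrite -ler_pdivrMr ?normr_gt0// mulrC.
apply: (ub_le_sup ubL); exists (`|v|^-1 *: v) => /=.
  by rewrite normrZ normfV normr_id mulVf ?normr_eq0.
by rewrite LZ normrZ normfV normr_id.
Qed.

Context {Z : normedModType R} {N : nat} {z : 'I_N -> Z}.
Hypothesis hz : is_basis z.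

Lemma basis_projZ (m : nat) (t : R) (v : Z) :
  basis_proj z m (t *: v) = t *: basis_proj z m v.
Proof.
by rewrite /basis_proj scaler_sumr; apply: eq_bigr => i _; rewrite coefZ// scalerA.
Qed.

(** The bound is uniform in [m], so that the set whose supremum is [proj_const] is bounded above. *)
Lemma basis_proj_bounded : exists2 b : R, 0 <= b &
  forall m v, `|basis_proj z m v| <= b * `|v|.
Proof.
have [c c0 zc] := coef_bounded hz.
exists (\sum_i c * `|z i|) => [|m v].
  by apply: sumr_ge0 => i _; rewrite mulr_ge0// ltW.
rewrite /basis_proj big_mkcond (le_trans (ler_norm_sum _ _ _))// mulr_suml.
apply: ler_sum => i _; have b0 : 0 <= c * `|z i| * `|v| by rewrite !mulr_ge0// ltW.
case: ifP => _; last by rewrite normr0.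
by rewrite normrZ mulrAC ler_wpM2r.
Qed.

Lemma op_norm_le_proj_const (p q : nat) : (p <= q <= N)%N ->
  op_norm (fun v => basis_proj z q v - basis_proj z p v) <= proj_const z.
Proof.
move=> pqN; have [b b0 zb] := basis_proj_bounded.
apply: ub_le_sup; last by exists (p, q).
exists (b + b) => _ [r _ <-]; apply: ge_sup.
  by exists `|basis_proj z r.2 0 - basis_proj z r.1 0|, 0 => //=; rewrite normr0.
move=> _ [v /= v1 <-].
by rewrite (le_trans (ler_normB _ _))// lerD// (le_trans (zb _ _))// ler_piMr.
Qed.

Lemma proj_const_ge0 : 0 <= proj_const z.
Proof.
apply: le_trans (@op_norm_le_proj_const 0 0 _); last by [].
rewrite /op_norm; set E := image _ _.
(* Without [has_sup] the supremum has the default value 0; with it, 0 belongs to [E]. *)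
have [hs|/sup_out->//] := pselect (has_sup E).
by apply: sup_upper_bound => //; exists 0; rewrite /= ?normr0// subrr normr0.
Qed.

(** Consecutive projections [P_(j+1)] and [P_j] differ by the single term [coef z v j *: z j]. *)
Lemma coef_proj_const (v : Z) (j : 'I_N) :
  `|coef z v j| * `|z j| <= proj_const z * `|v|.
Proof.
pose L v := basis_proj z j.+1 v - basis_proj z j v.
have LE : L v = coef z v j *: z j.
  rewrite /L /basis_proj (bigD1 j)//= (eq_bigl (fun i : 'I_N => (i < j)%N)) ?addrK//.
  by move=> i; rewrite ltnS ltn_neqAle andbC.
have [b b0 zb] := basis_proj_bounded.
rewrite -normrZ -LE (le_trans (op_norm_bound _ _ _))//.
- by move=> t u; rewrite /L !basis_projZ scalerBr.
- exists (b + b) => u; rewrite mulrDl (le_trans (ler_normB _ _))// lerD//.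
- by rewrite ler_wpM2r// op_norm_le_proj_const// leqnSn ltn_ord.
Qed.

End Projections.

(** * Support and coefficients of quantized vectors *)

Section QuantizedSums.
Context {R : realType}.

(** Since [f] tends to infinity, the set defining [inv_inc f y] is bounded above, so its supremum
    dominates its elements. *)
Lemma le_inv_inc (f : R -> R) (t y : R) : pos_increasing f ->
  (fun k : nat => f k%:R) @ \oo --> +oo -> 0 < t -> f t <= y -> t <= inv_inc f y.
Proof.
move=> [_ finc] flim t0 fty.
have [k [yk k0]] : exists k : nat, y < f k%:R /\ 0 < k%:R :> R.
  have /filter_ex[k [? ?]] : \forall k \near \oo, y < f k%:R /\ 0 < k%:R :> R.
    near=> k; split; last by rewrite ltr0n; near: k; exact: nbhs_infty_gt.
    by near: k; exact: cvgry_gt.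
  by exists k.
apply: ub_le_sup; last by [].
exists k%:R => s /= [s0 fsy]; rewrite leNgt; apply/negP => ks.
have := finc _ _ k0 ks; lra.
Unshelve. all: by end_near. Qed.

Lemma sparse_net_dim (X : normedModType R) (n : nat) (J : finType) (y : J -> X)
    (k K : nat) (delta eps : R) :
  has_dim X n -> (0 < n)%N -> 0 < eps < 1 ->
  (forall v : X, `|v| <= 1 -> exists m : J -> int,
    [/\ (#|[pred j | m j != 0]| <= k)%N, forall j, (`|m j| <= K)%N
      & `|v - \sum_j ((m j)%:~R * delta) *: y j| <= eps]) ->
  [/\ (0 < k)%N, (0 < #|J|)%N
    & n%:R * ln (1 / eps) <= k%:R * (ln #|J|%:R + ln (2 * K%:R + 1))].
Proof.
move=> dX n0 /[dup] epsb /andP[eps0 eps1] dense.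
(* If [k = 0] or [J] is empty, every admissible [m] vanishes, so 0 alone is a net and [n = 0], which
   is excluded. *)
have [kJ0|] := eqVneq (k * #|J|)%N 0%N.
  exfalso; suff nE : n = 0%N by rewrite nE in n0.
  apply: (zero_net_dim dX epsb) => v /dense[m [mk _]].
  rewrite big1 ?subr0// => j _.
  suff -> : m j = 0 by rewrite mul0r scale0r.
  apply/eqP; apply: contra_eqT kJ0 => mj.
  rewrite -lt0n muln_gt0; apply/andP; split; last by apply/card_gt0P; exists j.
  by apply: leq_trans mk; apply/card_gt0P; exists j.
rewrite muln_eq0 negb_or -!lt0n => /andP[k0 J0]; split => //.
have /card_gt0P[j0 _] := J0.
have := sparse_net_card j0 dX eps0 dense.
rewrite div1r lnV ?posrE// natrX natrM -addn1 natrD -mul2n natrM => h.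
have K0 : 0 < 2 * K%:R + 1 :> R by rewrite ltr_wpDl// mulr_ge0.
have P0 : 0 < #|J|%:R * (2 * K%:R + 1) :> R.
  by rewrite mulr_gt0 ?ltr0n.
have : ln 1 <= ln ((#|J|%:R * (2 * K%:R + 1)) ^+ k * eps ^+ n).
  by rewrite ler_ln ?posrE// mulr_gt0 ?exprn_gt0.
rewrite ln1 lnM ?posrE ?exprn_gt0// !lnXn// lnM ?posrE ?ltr0n//.
rewrite -[ln eps *+ _]mulr_natl -mulr_natl; lra.
Qed.

Context {Z : normedModType R} {N : nat} {z : 'I_N -> Z}.

(** Condition (ii) on the support [A] of [m] gives [f #|A| <= C / delta] once [delta] is factored
    out; the empty support is treated apart. *)
Lemma quantized_support (f : R -> R) (delta C : R) (m : 'I_N -> int) :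
  pos_increasing f -> (fun k : nat => f k%:R) @ \oo --> +oo -> 0 < delta ->
  (forall (A : {set 'I_N}) (m : 'I_N -> int), A != finset.set0 ->
     (forall j, j \in A -> m j != 0) ->
     f #|A|%:R <= `|\sum_(j in A) (m j)%:~R *: z j|) ->
  `|\sum_j ((m j)%:~R * delta) *: z j| <= C ->
  (#|[pred j | m j != 0%R]| <= Num.truncn (inv_inc f (C / delta)))%N.
Proof.
move=> hf flim d0 lowf mC.
pose A : {set 'I_N} := finset (fun j => m j != 0).
have -> : #|[pred j | m j != 0]| = #|A| by apply: eq_card => j; rewrite !inE.
have [->|A0] := eqVneq A finset.set0; first by rewrite cards0.
have cA : 0 < #|A|%:R :> R by rewrite ltr0n card_gt0.
have fA : #|A|%:R <= inv_inc f (C / delta).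
  apply: le_inv_inc => //.
  apply: le_trans (lowf A m A0 _) _ => [j|]; first by rewrite inE.
  rewrite ler_pdivlMr// -[X in _ * X](gtr0_norm d0) mulrC -normrZ.
  suff -> : delta *: \sum_(j in A) (m j)%:~R *: z j =
            \sum_j ((m j)%:~R * delta) *: z j by [].
  rewrite scaler_sumr big_mkcond; apply: eq_bigr => j _; rewrite inE.
  by case: eqP => [->|_] /=; rewrite ?mul0r ?scale0r// scalerA mulrC.
by rewrite truncn_ge_nat// (le_trans (ltW cA)).
Qed.

Lemma quantized_coef (delta C : R) (m : 'I_N -> int) (j : 'I_N) :
  is_basis z -> 0 < delta ->
  `|\sum_j ((m j)%:~R * delta) *: z j| <= C ->
  `|m j|%:R * `|z j| <= proj_const z * C / delta.
Proof.
move=> hz d0 mC; set v := \sum_j _ in mC.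
have := coef_proj_const hz v j.
rewrite (coef_unique hz (a := [ffun j => (m j)%:~R * delta])); last first.
  by apply: eq_bigr => i _; rewrite ffunE.
rewrite ffunE normrM (gtr0_norm d0) mulrAC ler_pdivlMr//.
rewrite -intr_norm natr_absz => /le_trans; apply.
by rewrite ler_wpM2l// proj_const_ge0.
Qed.

End QuantizedSums.

(** * An Auerbach-type basis and the sum of the norms *)

Section Auerbach.

(* Rows of largest determinant: by Cramer's rule the other rows have
   coordinates of modulus at most 1 with respect to them. *)
Lemma auerbach_rows (F : realFieldType) (n : nat) (I : finType)
    (w : I -> 'rV[F]_n) (s : {ffun 'I_n -> I}) :
  \det (\matrix_i w (s i)) != 0 ->
  exists (t : {ffun 'I_n -> I}) (D : 'M[F]_n),
    (forall v, v = \sum_i (v *m D) 0 i *: w (t i)) /\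
    (forall k i, `|(w k *m D) 0 i| <= 1).
Proof.
move=> ds; pose B (t : {ffun 'I_n -> I}) := \matrix_i w (t i).
case: (arg_maxP (i0 := s) (P := xpredT) (fun t => `|\det (B t)|)) => // t _ tmax.
have dB : \det (B t) != 0.
  by rewrite -normr_gt0 (lt_le_trans _ (tmax s _))// normr_gt0.
exists t, ((\det (B t))^-1 *: \adj (B t)); split=> [v|k i].
  have DB : (\det (B t))^-1 *: \adj (B t) *m B t = 1%:M.
    by rewrite -scalemxAl mul_adj_mx scale_scalar_mx mulVf.
  rewrite -[LHS]mulmx1 -DB mulmxA mulmx_sum_row; apply: eq_bigr => i _.
  by rewrite rowK.
rewrite -scalemxAr mxE normrM normfV ler_pdivrMl ?normr_gt0// mulr1.
(* Cramer's rule: the coordinate is the determinant with row [i] replaced by [w k], divided by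
   [\det (B t)]; maximality of [t] bounds the quotient. *)
pose t' : {ffun 'I_n -> I} := [ffun a => if a == i then k else t a].
suff -> : (w k *m \adj (B t)) 0 i = \det (B t') by exact: tmax.
rewrite (expand_det_row _ i) mxE; apply: eq_bigr => j _.
rewrite !mxE ffunE eqxx; congr (_ * (_ * \det _)).
by apply/matrixP => a b; rewrite !mxE ffunE eq_sym (negbTE (neq_lift _ _)).
Qed.

Context {R : realType} {X : normedModType R}.

(* The 1-summing norm of the identity of an n-dimensional space is at most n. *)
Lemma sum_norm_le_signs (n : nat) (J : finType) (y : J -> X) (s : R) :
  has_dim X n -> 0 < s ->
  (forall sg : {ffun J -> bool}, `|\sum_j (-1) ^+ sg j *: y j| <= s) ->
  \sum_j `|y j| <= n%:R * s.
Proof.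
move=> [e he] s0 ys.
(* Auerbach rows are chosen among all signed sums, whose coordinates must be controlled, and
   rescaled basis vectors, which supply a nonzero determinant. All have norm at most [s]. *)
pose W (p : {ffun J -> bool} + 'I_n) : X := match p with
  | inl sg => \sum_j (-1) ^+ sg j *: y j
  | inr i => (s / (1 + `|e i|)) *: e i end.
have e1 i : 0 < 1 + `|e i| by rewrite ltr_pwDl.
have Ws p : `|W p| <= s.
  case: p => [sg|i] /=; first exact: ys.
  rewrite normrZ gtr0_norm ?divr_gt0// -mulrA ler_piMr ?(ltW s0)//.
  by rewrite ler_pdivrMl// mulr1 lerDr.
pose rowof (v : X) : 'rV[R]_n := \row_k coef e v k.
have [|t [D [Dsum D1]]] := @auerbach_rows _ n _ (rowof \o W) [ffun i => inr i].
  rewrite (_ : \matrix_i _ = diag_mx (\row_i (s / (1 + `|e i|)))).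
    by rewrite det_diag; apply/prodf_neq0 => i _; rewrite mxE gt_eqF// divr_gt0.
  apply/matrixP => i j; rewrite !mxE ffunE /=.
  rewrite (coef_unique he (a := [ffun k => s / (1 + `|e i|) *+ (i == k)])); last first.
    rewrite (bigD1 i)//= ffunE eqxx mulr1n big1 ?addr0// => k ki.
    by rewrite ffunE eq_sym (negbTE ki) mulr0n scale0r.
  by rewrite ffunE.
pose b i (v : X) := (rowof v *m D) 0 i.
have bsum (v : X) : v = \sum_i b i v *: W (t i).
  rewrite {1}(coef_sum he v).
  under eq_bigr => k _.
    have /rowP/(_ k) := Dsum (rowof v); rewrite mxE summxE => ->.
    rewrite scaler_suml; under eq_bigr do rewrite mxE [rowof _ _ _]mxE -scalerA.
    over.
  rewrite exchange_big; apply: eq_bigr => i _.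
  by rewrite -scaler_sumr -(coef_sum he).
have blin i (a : J -> R) : b i (\sum_j a j *: y j) = \sum_j a j * b i (y j).
  rewrite /b mxE; under eq_bigr do rewrite mxE coef_lincomb// mulr_suml.
  rewrite exchange_big; apply: eq_bigr => j _; rewrite mxE mulr_sumr.
  by apply: eq_bigr => k _; rewrite mxE mulrA.
(* With the signs of [b i (y j)], this sum is the value of [b i] at one of the signed sums in
   [W]. *)
have b1 i : \sum_j `|b i (y j)| <= 1.
  pose sg : {ffun J -> bool} := [ffun j => b i (y j) < 0].
  apply: le_trans (D1 (inl sg) i); apply: le_trans (ler_norm _).
  rewrite -[leRHS]/(b i (\sum_j (-1) ^+ sg j *: y j)) blin.
  by apply: ler_sum => j _; rewrite ffunE normrEsign.
apply: (@le_trans _ _ (\sum_j \sum_i `|b i (y j)| * s)).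
  apply: ler_sum => j _; rewrite {1}(bsum (y j)) (le_trans (ler_norm_sum _ _ _))//.
  by apply: ler_sum => i _; rewrite normrZ ler_wpM2l.
rewrite exchange_big /= -[n in n%:R]card_ord -sum1_card natr_sum mulr_suml.
by apply: ler_sum => i _; rewrite -mulr_suml ler_wpM2r// ltW.
Qed.

End Auerbach.

(** * Frame vectors of norm at least [r] *)

Section LargeVectors.
Context {R : realType} {X : normedModType R} {N : nat}.

(** Deleting the vectors of norm below [r] removes at most [k] terms, each of norm at most
    [K * delta * r], so the remaining vectors still give a net, of radius
    [eps + k * (K * delta * r)]. *)
Lemma large_vectors_dim (n : nat) (x : 'I_N -> X) (k K : nat) (delta eps r : R) :
  has_dim X n -> (0 < n)%N -> 0 < delta -> 0 < eps -> 0 < r ->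
  eps + k%:R * (K%:R * delta * r) < 1 ->
  (forall v : X, `|v| <= 1 -> exists m : 'I_N -> int,
    [/\ (#|[pred j | m j != 0%R]| <= k)%N, forall j, (`|m j| <= K)%N
      & `|v - \sum_j ((m j)%:~R * delta) *: x j| <= eps]) ->
  let a := #|finset (fun j => r <= `|x j|)| in
  [/\ (0 < k)%N, (0 < a)%N &
    n%:R * ln (1 / (eps + k%:R * (K%:R * delta * r)))
      <= k%:R * (ln a%:R + ln (2 * K%:R + 1))].
Proof.
move=> dX n0 d0 eps0 r0; set eta := k%:R * _ => etaP dense.
set A := finset _.
have c0 : 0 <= K%:R * delta * r by rewrite mulr_ge0 ?mulr_ge0// ltW.
have eta0 : 0 <= eta by rewrite mulr_ge0.
have epsb : 0 < eps + eta < 1 by rewrite etaP ltr_wpDr.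
rewrite /=; have := sparse_net_dim (y := fun i : 'I_#|A| => x (enum_val i))
  (k := k) (K := K) (delta := delta) dX n0 epsb.
rewrite card_ord; apply => v /dense[m [mk mK vm]].
exists (fun i => m (enum_val i)); split => //.
  apply: leq_trans mk; rewrite -(fintype.card_image enum_val_inj).
  by apply/subset_leq_card/fintype.subsetP => _ /fintype.imageP[i + ->]; rewrite !inE.
pose H j : X := ((m j)%:~R * delta) *: x j.
rewrite -(big_enum_val (A := mem A) H).
have -> : v - \sum_(j in A) H j = (v - \sum_j H j) + \sum_(j | j \notin A) H j.
  by rewrite [\sum_j H j](bigID (mem A))/= opprD addrA subrK.
rewrite (le_trans (ler_normD _ _))// lerD// (le_trans (ler_norm_sum _ _ _))//.
apply: (@le_trans _ _ (\sum_(j | m j != 0) K%:R * delta * r)).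
  rewrite big_mkcond [leRHS]big_mkcond; apply: ler_sum => j _.
  rewrite /H inE; case: ifP => [|_]; last by case: ifP.
  rewrite -ltNge => xr; case: eqP => [->|_] /=; first by rewrite mul0r scale0r normr0.
  rewrite normrZ normrM (gtr0_norm d0) ler_pM//; last exact: ltW.
    by rewrite mulr_ge0// ltW.
  by rewrite ler_wpM2r ?(ltW d0)// -intr_norm -natr_absz ler_nat.
by rewrite sumr_const -[leLHS]mulr_natl /eta ler_wpM2r// ler_nat.
Qed.

(** The reconstruction operator sends signed sums of the [z j] over [A] to those of the [x j], which
    therefore have norm at most [M * g #|A|]; [sum_norm_le_signs] applies after extension by 0
    outside [A]. *)
Lemma large_vectors_growth (Z : normedModType R) (n : nat) (x : 'I_N -> X) (z : 'I_N -> Z)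
    (g : R -> R) (M : R) (A : {set 'I_N}) :
  has_dim X n -> is_basis z -> bounded_op (reconstruction x z) -> 0 < M ->
  op_norm (reconstruction x z) <= M -> 0 < g #|A|%:R -> max_signs z A <= g #|A|%:R ->
  \sum_(j in A) `|x j| <= n%:R * (M * g #|A|%:R).
Proof.
move=> dX hz Sb M0 SM g0 signs.
have Slin (a : 'I_N -> R) : reconstruction x z (\sum_j a j *: z j) = \sum_j a j *: x j.
  rewrite /reconstruction (coef_unique hz (a := [ffun j => a j])).
    by apply: eq_bigr => j _; rewrite ffunE.
  by apply: eq_bigr => j _; rewrite ffunE.
have SZ (t : R) u : reconstruction x z (t *: u) = t *: reconstruction x z u.
  by rewrite /reconstruction scaler_sumr; apply: eq_bigr => i _; rewrite coefZ// scalerA.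
pose y j := if j \in A then x j else 0.
have -> : \sum_(j in A) `|x j| = \sum_j `|y j|.
  rewrite big_mkcond; apply: eq_bigr => j _; rewrite /y.
  by case: ifP => // _; rewrite normr0.
apply: sum_norm_le_signs => // [|sg]; first by rewrite mulr_gt0.
pose a j : R := if j \in A then (-1) ^+ sg j else 0.
have -> : \sum_j (-1) ^+ sg j *: y j = reconstruction x z (\sum_j a j *: z j).
  rewrite Slin; apply: eq_bigr => j _; rewrite /a /y.
  by case: ifP => // _; rewrite scale0r scaler0.
rewrite (le_trans (op_norm_bound _ SZ Sb))// (le_trans (ler_wpM2r _ SM))//.
rewrite ler_pM2l//.
apply: le_trans signs; apply: le_trans (le_bigmax _ _ sg).
rewrite [in leRHS]big_mkcond le_eqVlt; apply/orP; left; apply/eqP; congr (`| _ |).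
by apply: eq_bigr => j _; rewrite /a; case: ifP => // _; rewrite scale0r.
Qed.

End LargeVectors.

(** * From the hypotheses on the frame to the two dimension bounds *)

(** [P] and [L] are left free for two uses: [proj_const z] and [1 / 2] for the entropy bound, [B]
    and [f 1] for constants independent of the space. *)
Lemma quantized_dense (R : realType) (X Z : normedModType R) (N : nat) (x : 'I_N -> X)
    (z : 'I_N -> Z) (f : R -> R) (delta C P L eps : R) :
  pos_increasing f -> (fun k : nat => f k%:R) @ \oo --> +oo -> 0 < delta -> 0 <= C ->
  is_basis z -> 0 < L -> (forall j, L <= `|z j|) -> proj_const z <= P ->
  (forall (A : {set 'I_N}) (m : 'I_N -> int), A != finset.set0 ->
     (forall j, j \in A -> m j != 0) ->
     f #|A|%:R <= `|\sum_(j in A) (m j)%:~R *: z j|) ->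
  eps_dense eps (quantized delta C x z) ->
  forall v : X, `|v| <= 1 -> exists m : 'I_N -> int,
    [/\ (#|[pred j | m j != 0%R]| <= Num.truncn (inv_inc f (C / delta)))%N,
        forall j, (`|m j| <= Num.truncn (P * C / delta / L))%N
      & `|v - \sum_j ((m j)%:~R * delta) *: x j| <= eps].
Proof.
move=> hf flim d0 C0 hz L0 zL zP low dense v /dense[_ [m /= mC <-] vm].
exists m; split => // [|j]; first exact: (quantized_support hf flim d0 low mC).
have P0 : 0 <= P := le_trans (proj_const_ge0 hz) zP.
have PC0 : 0 <= P * C / delta by rewrite divr_ge0 ?mulr_ge0// ltW.
rewrite truncn_ge_nat; last by apply: divr_ge0 => //; exact: ltW.
rewrite ler_pdivlMr//.
apply: le_trans (ler_wpM2l _ (zL j)) _ => //.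
apply: le_trans (quantized_coef j hz d0 mC) _.
by rewrite -!mulrA ler_wpM2r// divr_ge0// ltW.
Qed.

(* [g b * ln b <= theta * b] and [a * r <= n * M * g a] give
   [ln a <= n * l / (2 * kap)], which is half of what the entropy bound needs. *)
Lemma growth_dim_bound (R : realType) (g : R -> R) (n a a0 : nat) (l kap c r M : R) :
  0 < l -> 0 < kap -> 0 <= c -> 0 < r -> 0 < M -> (0 < a)%N -> (0 < a0)%N ->
  n%:R * l <= kap * (ln a%:R + c) ->
  a%:R * r <= n%:R * (M * g a%:R) ->
  (forall b : nat, (a0 <= b)%N -> g b%:R * ln b%:R / b%:R <= r * l / (2 * kap * M)) ->
  n%:R * l <= 2 * kap * (ln a0%:R + c).
Proof.
move=> l0 kap0 c0 r0 M0 a_gt0 a0_gt0 entropy growth g_small.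
have lna0 : 0 <= ln a0%:R :> R by rewrite ln_ge0// ler1n.
have lna : 0 <= ln a%:R :> R by rewrite ln_ge0// ler1n.
have aR : 0 < a%:R :> R by rewrite ltr0n.
(* For [a] below the threshold [a0], the entropy inequality and monotonicity of [ln] already
   suffice. *)
have [/g_small ga|/ltnW aa0] := leqP a0 a; last first.
  have : ln a%:R <= ln a0%:R :> R by rewrite ler_ln ?posrE ?ltr0n// ler_nat.
  nra.
move: ga; rewrite ler_pdivrMr// => ga.
suff lnle : kap * ln a%:R <= n%:R * l / 2 by nra.
have ar : 0 < 2 * (a%:R * r) by rewrite !mulr_gt0.
rewrite -(ler_pM2l ar).
apply: (@le_trans _ _ (2 * kap * (n%:R * M * (g a%:R * ln a%:R)))).
  have := ler_wpM2r (mulr_ge0 (ltW kap0) lna) growth; nra.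
have kap2 : 0 <= 2 * kap by rewrite mulr_ge0// ltW.
have nM : 0 <= n%:R * M by rewrite mulr_ge0// ltW.
apply: le_trans (ler_wpM2l kap2 (ler_wpM2l nM ga)) _.
rewrite le_eqVlt; apply/orP; left; apply/eqP; field.
by rewrite !gt_eqF.
Qed.

Theorem proposition4p3 (R : realType) (f g : R -> R)
    (hf : pos_increasing f) (hg : pos_increasing g)
    (hf_lim : (fun k : nat => f k%:R) @ \oo --> +oo)
    (hg_lim : (fun k : nat => g k%:R * ln k%:R / k%:R) @ \oo --> (0 : R))
    (C B M delta eps : R) (hC : 1 <= C) (hB : 1 <= B) (hM : 1 <= M)
    (hdelta : 0 < delta < 1) (heps : 0 < eps < 1) :
  exists n0 : nat,
  forall (n N : nat) (X Z : completeNormedModType R)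
    (x : 'I_N -> X) (phi : 'I_N -> {linear X -> R^o}) (z : 'I_N -> Z),
  has_dim X n ->
  is_frame x phi ->
  is_associated x phi z ->
  eps_dense eps (quantized delta C x z) ->
  (forall (A : {set 'I_N}) (m : 'I_N -> int), A != finset.set0 ->
     (forall j, j \in A -> m j != 0) ->
     f #|A|%:R <= `|\sum_(j in A) (m j)%:~R *: z j|) ->
  ((forall j, 1 / 2 <= `|z j|) ->
   ln N%:R >= n%:R * ln (1 / eps) / inv_inc f (C / delta)
              - ln (4 * proj_const z * C / delta + 1)) /\
  (proj_const z <= B ->
   op_norm (reconstruction x z) <= M ->
   (forall A : {set 'I_N}, A != finset.set0 -> g #|A|%:R >= max_signs z A) ->
   (n <= n0)%N).
Proof.
have /andP[d0 d1] := hdelta; have /andP[eps0 eps1] := heps.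
have C0 : 0 <= C by rewrite (le_trans _ hC).
have B0 : 0 <= B by rewrite (le_trans _ hB).
have M0 : 0 < M by rewrite (lt_le_trans _ hM).
have f1 : 0 < f 1 by apply: hf.1.
pose k := Num.truncn (inv_inc f (C / delta)).
pose K := Num.truncn (B * C / delta / f 1).
pose c : R := k%:R * (K%:R * delta).
have c0 : 0 <= c by rewrite !mulr_ge0// ltW.
(* Chosen so that the loss [c * r] is less than [1 - eps], which keeps [eps'] below 1. *)
pose r : R := (1 - eps) / (2 * (c + 1)).
have r0 : 0 < r by rewrite divr_gt0 ?subr_gt0// mulr_gt0// ltr_wpDl.
pose eps' : R := eps + k%:R * (K%:R * delta * r).
have eps'E : eps' = eps + c * r by rewrite /eps' /c; ring.
have eps'0 : 0 < eps' by rewrite eps'E ltr_wpDr// mulr_ge0// ltW.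
have eps'1 : eps' < 1.
  have -> : eps' = eps + (1 - eps) * (c / (2 * (c + 1))) by rewrite eps'E /r; ring.
  have : c / (2 * (c + 1)) < 1 by rewrite ltr_pdivrMr; lra.
  by have := eps1; nra.
pose l : R := ln (1 / eps').
have l0 : 0 < l by rewrite /l div1r lnV ?posrE// oppr_gt0 ln_lt0// eps'0.
(* [k.+1] instead of [k] ensures positivity, as [k] is not yet known to be nonzero. *)
pose kap : R := k.+1%:R; have kap0 : 0 < kap by rewrite ltr0n.
pose c2 : R := ln (2 * K%:R + 1).
have c20 : 0 <= c2 by rewrite ln_ge0// lerDr mulr_ge0.
have [a0 [a0_gt0 g_small]] : exists a0 : nat, (0 < a0)%N /\ forall b : nat, (a0 <= b)%N ->
    g b%:R * ln b%:R / b%:R <= r * l / (2 * kap * M).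
  have th0 : 0 < r * l / (2 * kap * M).
    by apply: divr_gt0; rewrite ?(mulr_gt0 r0 l0)// !mulr_gt0.
  have [a0 _ ga0] := cvgr0_norm_le _ hg_lim _ th0.
  exists a0.+1; split=> // b /ltnW /ga0; apply: le_trans; exact: ler_norm.
(* The conclusion of [growth_dim_bound] solved for [n]; no constant here depends on the spaces. *)
exists (Num.truncn (2 * kap * (ln a0%:R + c2) / l)).
move=> n N X Z x phi z dX _ [hz Sb _] dense low; split.
  move=> zhalf; have pc0 := proj_const_ge0 hz.
  (* The case [N = 0] relies on the default value [ln 0 = 0]. *)
  have LN : 0 <= ln N%:R :> R.
    by case: (N) => [|N']; [rewrite ln0 | rewrite ln_ge0 ?ler1n].
  have V1 : 1 <= 4 * proj_const z * C / delta + 1.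
    by rewrite lerDr divr_ge0 ?mulr_ge0// ltW.
  have [->|n0] := posnP n.
    by rewrite !mul0r sub0r (le_trans _ LN)// oppr_le0 ln_ge0.
  have half0 : 0 < 1 / 2 :> R by rewrite divr_gt0.
  have D := quantized_dense hf hf_lim d0 C0 hz half0 zhalf (lexx _) low dense.
  have [k0 N0 H] := sparse_net_dim dX n0 heps D.
  rewrite card_ord in N0 H.
  have L0 : 0 < inv_inc f (C / delta).
    rewrite -/k in k0; rewrite ltNge; apply/negP => L0.
    by move: k0; rewrite /k truncn_gt0; lra.
  have kL : k%:R <= inv_inc f (C / delta) by rewrite truncn_le ltW.
  rewrite lerBlDr ler_pdivrMr// [leRHS]mulrC.
  apply: le_trans H _; rewrite -/k.
  (* Dividing by the lower bound [1 / 2] doubles the coefficient bound, so [V] is at most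
     [4 * proj_const z * C / delta + 1]. *)
  set V := 2 * _ + 1.
  have V0 : 1 <= V by rewrite lerDr mulr_ge0.
  apply: ler_pM => //; first by rewrite addr_ge0// ln_ge0.
  rewrite lerD2l ler_ln ?posrE ?(lt_le_trans ltr01)// lerD2r.
  have : (Num.truncn (proj_const z * C / delta / (1 / 2)))%:R
      <= proj_const z * C / delta / (1 / 2) :> R.
    by rewrite truncn_le !divr_ge0 ?mulr_ge0// ltW.
  lra.
move=> pB SM signs.
have [->//|n0] := posnP n.
(* Condition (ii) for the singleton of [j] with coefficient 1. *)
have zf j : f 1 <= `|z j|.
  have := low (finset.set1 j) (fun=> 1); rewrite cards1 big_set1 scale1r; apply => //.
  by apply/finset.set0Pn; exists j; rewrite inE.
have D := quantized_dense hf hf_lim d0 C0 hz f1 zf pB low dense.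
have [k0 A0 entropy] := large_vectors_dim dX n0 d0 eps0 r0 eps'1 D.
set A := finset _ in A0 entropy.
rewrite -/k -/K -/eps' -/l -/c2 in entropy.
have g0 : 0 < g #|A|%:R by apply: hg.1; rewrite ltr0n.
have growth : #|A|%:R * r <= n%:R * (M * g #|A|%:R).
  apply: le_trans (large_vectors_growth dX hz Sb M0 SM g0 _); last first.
    by apply: signs; rewrite -card_gt0.
  rewrite mulr_natl -sumr_const; apply: ler_sum => j; by rewrite inE.
have bound0 : 0 <= 2 * kap * (ln a0%:R + c2).
  apply: mulr_ge0; first by rewrite mulr_ge0// ltW.
  by rewrite addr_ge0// ln_ge0// ler1n.
rewrite truncn_ge_nat; last by apply: divr_ge0 => //; exact: ltW.
rewrite ler_pdivlMr//.
apply: (growth_dim_bound l0 kap0 c20 r0 M0 A0 a0_gt0 _ growth g_small).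
apply: le_trans entropy _; rewrite ler_wpM2r ?ler_nat//.
by apply: addr_ge0 c20; apply: ln_ge0; rewrite ler1n.
Qed.
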